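(* Let $G$ be a finite simple graph and $\bar G$ its complement. Then (a) $\gamma^{\rm L}(G)=\gamma^{\rm L}(\bar G)$; (b) if $G$ has no closed twins, $\gamma^{\rm I}(G)=\gamma^{\rm O}(\bar G)$; (c) if $G$ has no open twins, $\gamma^{\rm O}(G)=\gamma^{\rm I}(\bar G)$; (d) if $G$ has neither open nor closed twins, $\gamma^{\rm F}(G)=\gamma^{\rm F}(\bar G)$.
   Context: For a graph $G=(V,E)$, $N(v)$ denotes the open and $N[v]=N(v)\cup\{v\}$ the closed neighborhood of $v$. Open twins are two non-adjacent vertices $u,v$ with $N(u)=N(v)$; closed twins are two adjacent vertices with $N[u]=N[v]$. A set $C\subseteq V$ is: a locating set (L-set) if the sets $N(v)\cap C$, $v\in V\setminus C$, are pairwise distinct; an open-separating set (O-set) if the sets $N(v)\cap C$, $v\in V$, are pairwise distinct; a closed-separating set (I-set) if the sets $N[v]\cap C$, $v\in V$, are pairwise distinct; a full-separating set (F-set) if it is both an O-set and an I-set. $\gamma^{\rm S}(G)$ is the minimum cardinality of an S-set of $G$ (defined when such a set exists). *)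

(* Defs.v *)
From HB Require Import structures.
From mathcomp Require Import all_boot.

Set Implicit Arguments.
Unset Strict Implicit.
Unset Printing Implicit Defensive.

Record sgraph := SGraph {
  vertex :> finType;
  adj : rel vertex;
  adj_sym : symmetric adj;
  adj_irrefl : irreflexive adj
}.

Section Complement.
Variable G : sgraph.

Definition compl_adj : rel G := fun u v => (u != v) && ~~ adj u v.

Lemma compl_adj_sym : symmetric compl_adj.
Proof. by move=> u v; rewrite /compl_adj eq_sym adj_sym. Qed.

Lemma compl_adj_irrefl : irreflexive compl_adj.
Proof. by move=> u; rewrite /compl_adj eqxx. Qed.

Definition compl : sgraph := SGraph compl_adj_sym compl_adj_irrefl.
End Complement.

Section SeparatingSets.
Variable G : sgraph.
Implicit Types (u v : G) (C : {set G}).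

Definition nbh v : {set G} := [set u | adj v u].
Definition cnbh v : {set G} := v |: nbh v.

Definition open_twins u v : bool :=
  [&& u != v, ~~ adj u v & nbh u == nbh v].
Definition closed_twins u v : bool :=
  [&& u != v, adj u v & cnbh u == cnbh v].

Definition has_open_twins : bool := [exists u, exists v, open_twins u v].
Definition has_closed_twins : bool := [exists u, exists v, closed_twins u v].

Definition L_set C : bool :=
  [forall u in ~: C, forall v in ~: C,
     (u != v) ==> (nbh u :&: C != nbh v :&: C)].
Definition O_set C : bool :=
  [forall u, forall v, (u != v) ==> (nbh u :&: C != nbh v :&: C)].
Definition I_set C : bool :=
  [forall u, forall v, (u != v) ==> (cnbh u :&: C != cnbh v :&: C)].
Definition F_set C : bool := O_set C && I_set C.
End SeparatingSets.

(* [None] exactly when no set satisfies [P], i.e. when the minimum is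
   undefined. *)
Definition min_card (T : finType) (P : pred {set T}) : option nat :=
  omap (fun C0 => #|[arg min_(C < C0 | P C) #|C|]|) [pick C | P C].

Definition gammaL (G : sgraph) : option nat := min_card (@L_set G).
Definition gammaO (G : sgraph) : option nat := min_card (@O_set G).
Definition gammaI (G : sgraph) : option nat := min_card (@I_set G).
Definition gammaF (G : sgraph) : option nat := min_card (@F_set G).

(* Equality of two such parameters asserts in particular that both are
   defined; [None] and [None] are not regarded as equal. *)
Definition eq_defined (a b : option nat) : Prop :=
  exists2 k : nat, a = Some k & b = Some k.

(* Main.v *)
(** The open (closed) neighborhoods of the complement graph are the complements
    of the closed (open) neighborhoods of [G], and complementing two sets does
    not change whether they have the same trace on [C].  Hence I-sets of [G] are
    O-sets of the complement and vice versa.  Outside [C] the traces of the open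
    and closed neighborhoods agree, so L-sets are preserved.  The parameters are
    defined because the full vertex set is separating in the absence of the
    relevant twins. *)
Require Import Defs.
From mathcomp Require Import all_boot.

Lemma min_card_eq_defined (T : finType) (P Q : pred {set T}) (C : {set T}) :
  P =1 Q -> P C -> eq_defined (min_card P) (min_card Q).
Proof.
move=> PQ PC; rewrite /min_card -(eq_pick PQ).
case: pickP => [C0 PC0 | /(_ C)]; last by rewrite PC.
eexists; first by [].
(* The minimizers for [P] and [Q] need not be the same set a priori, so their cardinalities are
   compared by minimality in both directions. *)
congr Some; case: arg_minnP => [|A QA Amin]; first by rewrite -PQ.
case: arg_minnP => // B PB Bmin.
by apply/eqP; rewrite eqn_leq Amin -?PQ // Bmin ?PQ.
Qed.

Lemma eq_setCI (T : finType) (A B C : {set T}) :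
  (~: A :&: C == ~: B :&: C) = (A :&: C == B :&: C).
Proof.
(* One implication suffices because complementation is involutive. *)
have imp (X Y : {set T}) : X :&: C = Y :&: C -> ~: X :&: C = ~: Y :&: C.
  move/setP=> XY; apply/setP=> x; move: (XY x).
  by rewrite !inE; case: (x \in C); rewrite ?andbT ?andbF // => ->.
by apply/eqP/eqP => /imp; rewrite ?setCK.
Qed.

Section Separation.
Variable G : sgraph.
Implicit Types (u v : G) (C : {set G}).

Lemma nbh_compl v : @nbh (compl G) v = ~: cnbh v.
Proof. by apply/setP=> u; rewrite !inE negb_or eq_sym. Qed.

Lemma cnbh_compl v : @cnbh (compl G) v = ~: nbh v.
Proof.
apply/setP=> u; rewrite !inE /= /compl_adj [v == u]eq_sym.
by case: eqVneq => [->|]; rewrite ?adj_irrefl.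
Qed.

Lemma cnbhI_notin v C : v \notin C -> cnbh v :&: C = nbh v :&: C.
Proof.
move=> vC; apply/setP=> u; rewrite !inE.
by case: eqVneq => [->|//]; rewrite (negbTE vC) !andbF.
Qed.

Lemma O_set_compl C : @O_set (compl G) C = I_set C.
Proof.
by do 2!apply: eq_forallb => ?; rewrite !nbh_compl eq_setCI.
Qed.

Lemma I_set_compl C : @I_set (compl G) C = O_set C.
Proof.
by do 2!apply: eq_forallb => ?; rewrite !cnbh_compl eq_setCI.
Qed.

Lemma F_set_compl C : @F_set (compl G) C = F_set C.
Proof. by rewrite /F_set O_set_compl I_set_compl andbC. Qed.

Lemma L_set_compl C : @L_set (compl G) C = L_set C.
Proof.
apply: eq_forallb => u; rewrite inE.
case uC: (u \in C) => //=; apply: eq_forallb => v; rewrite inE.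
case vC: (v \in C) => //=.
by rewrite !nbh_compl eq_setCI !cnbhI_notin ?uC ?vC.
Qed.

(** Vacuous, as no vertex lies outside the full set. *)
Lemma L_setT : L_set [set: G].
Proof. by apply/forall_inP => u; rewrite !inE. Qed.

Lemma O_setT : ~~ has_open_twins G -> O_set [set: G].
Proof.
move=> noT; apply/forallP=> u; apply/forallP=> v; apply/implyP=> uv.
rewrite !setIT; apply: contra noT => /eqP Nuv.
apply/existsP; exists u; apply/existsP; exists v.
rewrite /open_twins uv Nuv eqxx andbT.
(* Since $v \notin N(v) = N(u)$, the two vertices are non-adjacent. *)
by move/setP/(_ v): Nuv; rewrite !inE adj_irrefl => ->.
Qed.

Lemma I_setT : ~~ has_closed_twins G -> I_set [set: G].
Proof.
move=> noT; apply/forallP=> u; apply/forallP=> v; apply/implyP=> uv.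
rewrite !setIT; apply: contra noT => /eqP Nuv.
apply/existsP; exists u; apply/existsP; exists v.
rewrite /closed_twins uv Nuv eqxx andbT.
(* Since $v \in N[v] = N[u]$ and $v \neq u$, the two vertices are adjacent. *)
by move/setP/(_ v): Nuv; rewrite !inE eqxx eq_sym (negbTE uv) /= => ->.
Qed.

End Separation.

Theorem theorem7 (G : sgraph) :
  [/\ eq_defined (gammaL G) (gammaL (compl G)),
      ~~ has_closed_twins G -> eq_defined (gammaI G) (gammaO (compl G)),
      ~~ has_open_twins G -> eq_defined (gammaO G) (gammaI (compl G))
    & ~~ has_open_twins G -> ~~ has_closed_twins G ->
      eq_defined (gammaF G) (gammaF (compl G))].
Proof.
split=> [|noC|noO|noO noC].
- by apply: min_card_eq_defined (L_setT G) => C; rewrite L_set_compl.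
- by apply: min_card_eq_defined (I_setT _ noC) => C; rewrite O_set_compl.
- by apply: min_card_eq_defined (O_setT _ noO) => C; rewrite I_set_compl.
- apply: (@min_card_eq_defined _ _ _ [set: G]) => [C|].
    by rewrite F_set_compl.
  by rewrite /F_set O_setT ?I_setT.
Qed.
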